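(* Let $\mathcal{B}=(a_1,a_2)\subset\mathbb{R}$, $\tau>0$, and let $\rho_0>0$ and $k$ be constants. Let $e=e(p,s)$ be a smooth function and put $S(p,s)=\rho_0\,\partial e/\partial p$ and $\theta(p,s)=\partial e/\partial s$. Let $u(x,t)$ and $s(x,t)$ be smooth fields on $\overline{\mathcal{B}}\times[0,\tau]$ (displacement and entropy density), let $v=\partial_t u$, $q=-k\,\partial_x\theta$ and $I=e+\tfrac12 v^2$, with $e,S,\theta$ evaluated at $(\partial_x u,s)$, and suppose that the balance of momentum and the first law of thermodynamics hold: $$\rho_0\frac{\partial v}{\partial t}=\frac{\partial S}{\partial x},\qquad \rho_0\frac{\partial I}{\partial t}=\frac{\partial}{\partial x}\left(vS-q\right).$$ Put $c=\dfrac{\partial S}{\partial(\partial_x u)}$ and $$\dot D=\frac{\partial S}{\partial s}\,v\,\frac{\partial s}{\partial t}+\frac{\partial s}{\partial x}\left(S\,\frac{\partial\theta}{\partial(\partial_x u)}-\theta\,\frac{\partial S}{\partial(\partial_x u)}\right)-\frac{\partial q}{\partial t}.$$ Then the total energy $I$ satisfies $$\rho_0\frac{\partial^2 I}{\partial t^2}-\frac{\partial}{\partial x}\left(c\,\frac{\partial I}{\partial x}\right)-\frac{\partial\dot D}{\partial x}=0,$$ and this equation is the Euler–Lagrange equation of $$\int_0^\tau\Sigma(I)\,dt,\qquad \Sigma(I)=\int_{\mathcal{B}}\left(\frac{\rho_0}{2}\left(\frac{\partial I}{\partial t}\right)^2-\frac{c}{2}\left(\frac{\partial I}{\partial x}\right)^2-\dot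 D\,\frac{\partial I}{\partial x}\right)dx .$$ Consequently the evolution of the total energy in $[0,\tau]$ coincides with the stationary points of $\int_0^\tau\Sigma\,dt$: a smooth field $I$ satisfies $\rho_0\frac{\partial^2 I}{\partial t^2}-\frac{\partial}{\partial x}\left(c\,\frac{\partial I}{\partial x}\right)-\frac{\partial\dot D}{\partial x}=0$ if and only if it is a stationary point of the functional $\int_0^\tau\Sigma(I)\,dt$.
   Context: One-dimensional (possibly nonlinear) thermoelastic medium in material coordinates, with Fourier heat conduction and without body forces or heat sources. $\partial S/\partial(\partial_x u)$ and $\partial\theta/\partial(\partial_x u)$ denote derivatives in the first argument $p$, evaluated at $p=\partial_x u$. In the functional, $c=c(x,t)$ and $\dot D=\dot D(x,t)$ are fixed given functions, computed from the actual motion, and are not varied; only $I$ is varied. A field $I$ is a stationary point if $\frac{d}{d\epsilon}\big|_{\epsilon=0}\int_0^\tau\Sigma(I+\epsilon\varphi)\,dt=0$ for every smooth $\varphi$ compactly supported in $\mathcal{B}\times(0,\tau)$. *)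

(* Defs.v *)
From Stdlib Require Import Reals.
From Coquelicot Require Import Coquelicot.
Open Scope R_scope.

Definition D1 (f : R -> R -> R) (x y : R) : R := Derive (fun z => f z y) x.
Definition D2 (f : R -> R -> R) (x y : R) : R := Derive (fun z => f x z) y.

(* [f] is C^infinity on an open neighbourhood of [K].  For a closed [K] this is
   the usual meaning of "smooth on K" (restriction to [K] of a smooth function
   on a neighbourhood); the field is then represented by such an extension. *)
Definition smooth_on (K : R -> R -> Prop) (f : R -> R -> R) : Prop :=
  forall x y, K x y ->
    locally_2d (fun x' y' => forall n, ex_diff_n f n x' y') x y.

Definition plane (x y : R) : Prop := True.
Definition cylinder (a1 a2 tau x t : R) : Prop := a1 < x < a2 /\ 0 < t < tau.
Definition closed_cylinder (a1 a2 tau x t : R) : Prop :=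
  a1 <= x <= a2 /\ 0 <= t <= tau.

(* Support contained in a compact subset of the open cylinder: such a subset
   lies in a compact rectangle [b1,b2] x [t1,t2]. *)
Definition compactly_supported (a1 a2 tau : R) (phi : R -> R -> R) : Prop :=
  exists b1 b2 t1 t2 : R,
    a1 < b1 /\ b1 <= b2 /\ b2 < a2 /\ 0 < t1 /\ t1 <= t2 /\ t2 < tau /\
    forall x t, ~ (b1 <= x <= b2 /\ t1 <= t <= t2) -> phi x t = 0.

(* Constitutive functions, of (p, s). *)
Definition stress (rho0 : R) (e : R -> R -> R) (p s : R) : R := rho0 * D1 e p s.
Definition temperature (e : R -> R -> R) (p s : R) : R := D2 e p s.

(* A constitutive function evaluated along the motion, as a field of (x, t). *)
Definition along (g u s : R -> R -> R) (x t : R) : R := g (D1 u x t) (s x t).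

Definition velocity (u : R -> R -> R) (x t : R) : R := D2 u x t.

Definition heat_flux (k : R) (e u s : R -> R -> R) (x t : R) : R :=
  - k * D1 (along (temperature e) u s) x t.

Definition total_energy (e u s : R -> R -> R) (x t : R) : R :=
  along e u s x t + / 2 * velocity u x t ^ 2.

Definition stiffness (rho0 : R) (e u s : R -> R -> R) : R -> R -> R :=
  along (D1 (stress rho0 e)) u s.

Definition dissipation (rho0 k : R) (e u s : R -> R -> R) (x t : R) : R :=
  along (D2 (stress rho0 e)) u s x t * velocity u x t * D2 s x t
  + D1 s x t
    * (along (stress rho0 e) u s x t * along (D1 (temperature e)) u s x t
       - along (temperature e) u s x t * along (D1 (stress rho0 e)) u s x t)
  - D2 (heat_flux k e u s) x t.

(* Lagrangian densities L x t y a b, with y, a, b standing for J, J_t, J_x. *)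
Definition density := R -> R -> R -> R -> R -> R.

Definition energy_density (rho0 : R) (c D : R -> R -> R) : density :=
  fun x t _ a b => rho0 / 2 * a ^ 2 - c x t / 2 * b ^ 2 - D x t * b.

(* The functionals below depend only on the values of [J] in the open cylinder,
   since [RInt] ignores the values of the integrand at the endpoints. *)
Definition Sigma (L : density) (a1 a2 : R) (J : R -> R -> R) (t : R) : R :=
  RInt (fun x => L x t (J x t) (D2 J x t) (D1 J x t)) a1 a2.

Definition action (L : density) (a1 a2 tau : R) (J : R -> R -> R) : R :=
  RInt (fun t => Sigma L a1 a2 J t) 0 tau.

Definition stationary (L : density) (a1 a2 tau : R) (J : R -> R -> R) : Prop :=
  forall phi : R -> R -> R,
    smooth_on plane phi ->
    compactly_supported a1 a2 tau phi ->
    is_derive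
      (fun eps : R => action L a1 a2 tau (fun x t => J x t + eps * phi x t)) 0 0.

(* Left-hand side of the Euler-Lagrange equation
   (dL/dJ_t)_t + (dL/dJ_x)_x - dL/dJ = 0. *)
Definition euler_lagrange (L : density) (J : R -> R -> R) (x t : R) : R :=
  D2 (fun x' t' =>
        Derive (fun a => L x' t' (J x' t') a (D1 J x' t')) (D2 J x' t')) x t
  + D1 (fun x' t' =>
          Derive (fun b => L x' t' (J x' t') (D2 J x' t') b) (D1 J x' t')) x t
  - Derive (fun y => L x t y (D2 J x t) (D1 J x t)) (J x t).

(* Main.v *)
Require Import Defs.
From Stdlib Require Import Reals Lra Lia.
From Coquelicot Require Import Coquelicot.
Open Scope R_scope.

(** Differentiating the first law in [t] and exchanging derivatives turns
    [rho0 I_tt] into the [x]-derivative of [(v S - q)_t]; by the chain rule, the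
    momentum balance and the Maxwell relation [dS/ds = rho0 dtheta/dp], the latter
    is [c I_x + D].  The density is quadratic in the derivatives of [J], so the
    action along [J + eps phi] is a quadratic polynomial in [eps]; integration by
    parts turns its linear coefficient into minus the integral of the
    left-hand side times [phi], and testing with a bump function localizes. *)

(** * Smooth functions of two variables *)

(** The fields are controlled only near the closed cylinder, so all calculus is done with germs:
    [smooth_on K f] unfolds to [smooth_at f x y] at every point of [K]. Because one neighbourhood
    serves all orders, [smooth_at] is an open condition. The balance laws hold only in the open
    cylinder, also an open set, and this is what permits differentiating them.

    The integrals are iterated, with [x] inside and [t] outside, and this makes the two integrations
    by parts asymmetric. The total [x]-derivative already vanishes in the inner integral, for each
    [t]. The total [t]-derivative must first be pulled out of the inner integral by differentiation
    under the integral sign, which replaces an exchange of the order of integration and asks for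
    smoothness on a whole strip in [t]; the compact support of the test function provides it. *)

Definition smooth_at (f : R -> R -> R) (x y : R) : Prop :=
  locally_2d (fun x' y' => forall n, ex_diff_n f n x' y') x y.

Lemma locally_2d_mono (P Q : R -> R -> Prop) x y :
  (forall u v, P u v -> Q u v) -> locally_2d P x y -> locally_2d Q x y.
Proof.
  intros H; apply locally_2d_impl, locally_2d_forall, H.
Qed.

(** A neighbourhood of a point contains a neighbourhood of each point near it. So an implication
    whose premise is itself local can be applied all around the point. *)
Lemma locally_2d_mono_strong (P Q : R -> R -> Prop) x y :
  (forall u v, locally_2d P u v -> Q u v) ->
  locally_2d P x y -> locally_2d Q x y.
Proof.
  intros H; apply locally_2d_impl_strong, locally_2d_forall, H.
Qed.

Lemma ex_diff_n_S_iff f n x y :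
  ex_diff_n f (S n) x y <->
  continuity_2d_pt f x y /\ ex_derive (fun z => f z y) x /\
  ex_derive (fun z => f x z) y /\
  ex_diff_n (D1 f) n x y /\ ex_diff_n (D2 f) n x y.
Proof. reflexivity. Qed.

Lemma ex_diff_n_continuity f n x y :
  ex_diff_n f n x y -> continuity_2d_pt f x y.
Proof. destruct n; intros H; apply H. Qed.

Lemma ex_diff_n_pred f n x y : ex_diff_n f (S n) x y -> ex_diff_n f n x y.
Proof. apply ex_diff_n_m; lia. Qed.

Lemma locally_ex_diff_n_D1 f n x y :
  locally_2d (ex_diff_n f (S n)) x y -> locally_2d (ex_diff_n (D1 f) n) x y.
Proof. apply locally_2d_mono; intros u v H; apply H. Qed.

Lemma locally_ex_diff_n_D2 f n x y :
  locally_2d (ex_diff_n f (S n)) x y -> locally_2d (ex_diff_n (D2 f) n) x y.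
Proof. apply locally_2d_mono; intros u v H; apply H. Qed.

Lemma ex_diff_n_const c n x y : ex_diff_n (fun _ _ => c) n x y.
Proof.
  revert c; induction n as [|n IH]; intros c.
  - split; [apply continuity_2d_pt_const | exact I].
  - apply ex_diff_n_S_iff; repeat split.
    + apply continuity_2d_pt_const.
    + apply ex_derive_const.
    + apply ex_derive_const.
    + apply ex_diff_n_ext_loc with (2 := IH 0), locally_2d_forall.
      intros u v; unfold D1; now rewrite Derive_const.
    + apply ex_diff_n_ext_loc with (2 := IH 0), locally_2d_forall.
      intros u v; unfold D2; now rewrite Derive_const.
Qed.

(** The premises are local because the sum rule must identify the partial derivatives as functions
    near the point before the next order can be treated. *)
Lemma ex_diff_n_plus f g n x y :
  locally_2d (ex_diff_n f n) x y -> locally_2d (ex_diff_n g n) x y ->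
  ex_diff_n (fun u v => f u v + g u v) n x y.
Proof.
  revert f g x y; induction n as [|n IH]; intros f g x y Hf Hg.
  - split; [|exact I].
    apply continuity_2d_pt_plus; eapply ex_diff_n_continuity;
      eapply locally_2d_singleton; eassumption.
  - pose proof (locally_2d_singleton _ _ _ Hf) as Hf0.
    pose proof (locally_2d_singleton _ _ _ Hg) as Hg0.
    pose proof (locally_2d_and _ _ _ _ Hf Hg) as Hfg.
    apply ex_diff_n_S_iff in Hf0; apply ex_diff_n_S_iff in Hg0.
    destruct Hf0 as (cf & f1 & f2 & _), Hg0 as (cg & g1 & g2 & _).
    apply ex_diff_n_S_iff; repeat split.
    + now apply continuity_2d_pt_plus.
    + now apply (ex_derive_plus (V := R_NormedModule)).
    + now apply (ex_derive_plus (V := R_NormedModule)).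
    + apply ex_diff_n_ext_loc with (fun u v => D1 f u v + D1 g u v).
      * eapply locally_2d_mono; [|exact Hfg].
        intros u v [(_ & a & _) (_ & b & _)]; symmetry; now apply Derive_plus.
      * apply IH; auto using locally_ex_diff_n_D1, locally_ex_diff_n_D2.
    + apply ex_diff_n_ext_loc with (fun u v => D2 f u v + D2 g u v).
      * eapply locally_2d_mono; [|exact Hfg].
        intros u v [(_ & _ & a & _) (_ & _ & b & _)]; symmetry; now apply Derive_plus.
      * apply IH; auto using locally_ex_diff_n_D1, locally_ex_diff_n_D2.
Qed.

Lemma ex_diff_n_mult f g n x y :
  locally_2d (ex_diff_n f n) x y -> locally_2d (ex_diff_n g n) x y ->
  ex_diff_n (fun u v => f u v * g u v) n x y.
Proof.
  revert f g x y; induction n as [|n IH]; intros f g x y Hf Hg.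
  - split; [|exact I].
    apply continuity_2d_pt_mult; eapply ex_diff_n_continuity;
      eapply locally_2d_singleton; eassumption.
  - pose proof (locally_2d_singleton _ _ _ Hf) as Hf0.
    pose proof (locally_2d_singleton _ _ _ Hg) as Hg0.
    pose proof (locally_2d_and _ _ _ _ Hf Hg) as Hfg.
    apply ex_diff_n_S_iff in Hf0; apply ex_diff_n_S_iff in Hg0.
    destruct Hf0 as (cf & f1 & f2 & _), Hg0 as (cg & g1 & g2 & _).
    assert (Hpf : locally_2d (ex_diff_n f n) x y)
      by (eapply locally_2d_mono; [|exact Hf]; intros; now apply ex_diff_n_pred).
    assert (Hpg : locally_2d (ex_diff_n g n) x y)
      by (eapply locally_2d_mono; [|exact Hg]; intros; now apply ex_diff_n_pred).
    (* The induction hypothesis concludes at a single point, but the product rule yields a sum of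
       products and [ex_diff_n_plus] wants each summand on a neighbourhood. *)
    assert (IH' : forall f g x y,
      locally_2d (ex_diff_n f n) x y -> locally_2d (ex_diff_n g n) x y ->
      locally_2d (ex_diff_n (fun u v => f u v * g u v) n) x y).
    { intros f' g' x' y' H H'.
      eapply locally_2d_mono_strong; [|exact (locally_2d_and _ _ _ _ H H')].
      intros u v Huv; apply IH; eapply locally_2d_mono; try exact Huv;
        intros ? ? K; apply K. }
    apply ex_diff_n_S_iff; repeat split.
    + now apply continuity_2d_pt_mult.
    + now apply ex_derive_mult.
    + now apply ex_derive_mult.
    + apply ex_diff_n_ext_loc with
        (fun u v => D1 f u v * g u v + f u v * D1 g u v).
      * eapply locally_2d_mono; [|exact Hfg].
        intros u v [(_ & a & _) (_ & b & _)]; symmetry; now apply Derive_mult.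
      * apply ex_diff_n_plus; apply IH';
          auto using locally_ex_diff_n_D1, locally_ex_diff_n_D2.
    + apply ex_diff_n_ext_loc with
        (fun u v => D2 f u v * g u v + f u v * D2 g u v).
      * eapply locally_2d_mono; [|exact Hfg].
        intros u v [(_ & _ & a & _) (_ & _ & b & _)]; symmetry; now apply Derive_mult.
      * apply ex_diff_n_plus; apply IH';
          auto using locally_ex_diff_n_D1, locally_ex_diff_n_D2.
Qed.

Lemma smooth_at_locally f x y : smooth_at f x y -> locally_2d (smooth_at f) x y.
Proof. apply locally_2d_mono_strong; intros u v H; exact H. Qed.

Lemma smooth_at_ex_diff_n f n x y :
  smooth_at f x y -> locally_2d (ex_diff_n f n) x y.
Proof. apply locally_2d_mono; intros u v H; apply H. Qed.

(** Here [P] collects what is known about the ingredients of [f]. Proving each finite order where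
    [P] holds locally gives all orders on the single neighbourhood where [P] holds. *)
Lemma smooth_at_intro f x y (P : R -> R -> Prop) :
  locally_2d P x y ->
  (forall u v, locally_2d P u v -> forall n, ex_diff_n f n u v) ->
  smooth_at f x y.
Proof. intros HP H; eapply locally_2d_mono_strong; [|exact HP]; exact H. Qed.

Lemma smooth_at_ext_loc f g x y :
  locally_2d (fun u v => f u v = g u v) x y -> smooth_at f x y -> smooth_at g x y.
Proof.
  intros He Hf; eapply smooth_at_intro with (1 := locally_2d_and _ _ _ _ He Hf).
  intros u v H n; apply ex_diff_n_ext_loc with f.
  - eapply locally_2d_mono; [|exact H]; now intros ? ? [].
  - apply (locally_2d_singleton _ _ _ H).
Qed.

Lemma smooth_at_D1 f x y : smooth_at f x y -> smooth_at (D1 f) x y.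
Proof. apply locally_2d_mono; intros u v H n; apply (H (S n)). Qed.

Lemma smooth_at_D2 f x y : smooth_at f x y -> smooth_at (D2 f) x y.
Proof. apply locally_2d_mono; intros u v H n; apply (H (S n)). Qed.

Lemma smooth_at_const c x y : smooth_at (fun _ _ => c) x y.
Proof. apply locally_2d_forall; intros u v n; apply ex_diff_n_const. Qed.

Lemma smooth_at_plus f g x y :
  smooth_at f x y -> smooth_at g x y -> smooth_at (fun u v => f u v + g u v) x y.
Proof.
  intros Hf Hg; eapply smooth_at_intro with (1 := locally_2d_and _ _ _ _ Hf Hg).
  intros u v H n; apply ex_diff_n_plus; eapply locally_2d_mono; try exact H;
    intros ? ? K; apply K.
Qed.

Lemma smooth_at_mult f g x y :
  smooth_at f x y -> smooth_at g x y -> smooth_at (fun u v => f u v * g u v) x y.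
Proof.
  intros Hf Hg; eapply smooth_at_intro with (1 := locally_2d_and _ _ _ _ Hf Hg).
  intros u v H n; apply ex_diff_n_mult; eapply locally_2d_mono; try exact H;
    intros ? ? K; apply K.
Qed.

Lemma smooth_at_scal c f x y :
  smooth_at f x y -> smooth_at (fun u v => c * f u v) x y.
Proof. apply smooth_at_mult, smooth_at_const. Qed.

Lemma smooth_at_minus f g x y :
  smooth_at f x y -> smooth_at g x y -> smooth_at (fun u v => f u v - g u v) x y.
Proof.
  intros Hf Hg; apply smooth_at_ext_loc with (fun u v => f u v + (-1) * g u v).
  - apply locally_2d_forall; intros; ring.
  - apply smooth_at_plus; [|apply smooth_at_scal]; trivial.
Qed.

Lemma smooth_at_continuity f x y : smooth_at f x y -> continuity_2d_pt f x y.
Proof. intros H; exact (proj1 (locally_2d_singleton _ _ _ H 0%nat)). Qed.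

Lemma smooth_at_ex_derive1 f x y :
  smooth_at f x y -> ex_derive (fun z => f z y) x.
Proof. intros H; apply (locally_2d_singleton _ _ _ H 1%nat). Qed.

Lemma smooth_at_ex_derive2 f x y :
  smooth_at f x y -> ex_derive (fun z => f x z) y.
Proof. intros H; apply (locally_2d_singleton _ _ _ H 1%nat). Qed.

Lemma smooth_at_D1_D2 f x y : smooth_at f x y -> D1 (D2 f) x y = D2 (D1 f) x y.
Proof.
  intros H; apply Schwarz.
  - eapply locally_2d_mono; [|apply smooth_at_locally, H].
    intros u v K; repeat split.
    + now apply smooth_at_ex_derive1.
    + now apply smooth_at_ex_derive2.
    + apply (smooth_at_ex_derive1 (D2 f)); now apply smooth_at_D2.
    + apply (smooth_at_ex_derive2 (D1 f)); now apply smooth_at_D1.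
  - apply (smooth_at_continuity (D1 (D2 f))); now apply smooth_at_D1, smooth_at_D2.
  - apply (smooth_at_continuity (D2 (D1 f))); now apply smooth_at_D2, smooth_at_D1.
Qed.

(** Total differentiability follows from one partial derivative that exists nearby and is continuous
    at the point, plus the other one at the point alone. The chain rule needs this total form. *)
Lemma smooth_at_differentiable f x y :
  smooth_at f x y -> differentiable_pt_lim f x y (D1 f x y) (D2 f x y).
Proof.
  intros H; apply filterdiff_differentiable_pt_lim.
  apply (is_derive_filterdiff f x y (D1 f) (D2 f x y)).
  - apply (proj1 (locally_2d_locally
      (fun u v => is_derive (fun z => f z v) u (D1 f u v)) x y)).
    eapply locally_2d_mono; [|apply smooth_at_locally, H].
    intros u v K; apply Derive_correct; now apply smooth_at_ex_derive1.
  - apply Derive_correct; now apply smooth_at_ex_derive2.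
  - apply continuity_2d_pt_filterlim, smooth_at_continuity, smooth_at_D1, H.
Qed.

(** Preimages of neighbourhoods under a continuous map are neighbourhoods. With [P] an epsilon-ball
    this gives continuity of compositions; with [P := smooth_at g] it keeps the outer function
    smooth along nearby values. *)
Lemma continuity_2d_pt_locally_comp (P : R -> R -> Prop) a b x y :
  continuity_2d_pt a x y -> continuity_2d_pt b x y ->
  locally_2d P (a x y) (b x y) -> locally_2d (fun u v => P (a u v) (b u v)) x y.
Proof.
  intros Ca Cb [eps HP].
  pose proof (locally_2d_and _ _ _ _ (Ca eps) (Cb eps)) as H.
  eapply locally_2d_mono; [|exact H].
  intros u v [Ha Hb]; now apply HP.
Qed.

Lemma smooth_at_comp_is_derive1 g a b x y :
  smooth_at g (a x y) (b x y) -> smooth_at a x y -> smooth_at b x y ->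
  is_derive (fun z => g (a z y) (b z y)) x
    (D1 g (a x y) (b x y) * D1 a x y + D2 g (a x y) (b x y) * D1 b x y).
Proof.
  intros Hg Ha Hb; apply is_derive_Reals.
  apply (derivable_pt_lim_comp_2d g (fun z => a z y) (fun z => b z y)).
  - now apply smooth_at_differentiable.
  - apply is_derive_Reals, Derive_correct; now apply smooth_at_ex_derive1.
  - apply is_derive_Reals, Derive_correct; now apply smooth_at_ex_derive1.
Qed.

Lemma smooth_at_comp_is_derive2 g a b x y :
  smooth_at g (a x y) (b x y) -> smooth_at a x y -> smooth_at b x y ->
  is_derive (fun z => g (a x z) (b x z)) y
    (D1 g (a x y) (b x y) * D2 a x y + D2 g (a x y) (b x y) * D2 b x y).
Proof.
  intros Hg Ha Hb; apply is_derive_Reals.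
  apply (derivable_pt_lim_comp_2d g (fun z => a x z) (fun z => b x z)).
  - now apply smooth_at_differentiable.
  - apply is_derive_Reals, Derive_correct; now apply smooth_at_ex_derive2.
  - apply is_derive_Reals, Derive_correct; now apply smooth_at_ex_derive2.
Qed.

Lemma continuity_2d_pt_comp g a b x y :
  continuity_2d_pt g (a x y) (b x y) ->
  continuity_2d_pt a x y -> continuity_2d_pt b x y ->
  continuity_2d_pt (fun u v => g (a u v) (b u v)) x y.
Proof.
  intros Cg Ca Cb eps.
  now apply (continuity_2d_pt_locally_comp
    (fun p q => Rabs (g p q - g (a x y) (b x y)) < eps)).
Qed.

Lemma smooth_at_comp g a b x y :
  smooth_at g (a x y) (b x y) -> smooth_at a x y -> smooth_at b x y ->
  smooth_at (fun u v => g (a u v) (b u v)) x y.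
Proof.
  (* The outer function stays a parameter: the chain rule replaces [g] by [D1 g] and [D2 g] at each
     order, while [a] and [b] remain fixed. *)
  set (P g u v := smooth_at g (a u v) (b u v) /\ smooth_at a u v /\ smooth_at b u v).
  assert (HP : forall g u v, P g u v -> locally_2d (P g) u v).
  { intros f u v (Hf & Ha & Hb); apply locally_2d_and.
    - apply (continuity_2d_pt_locally_comp (smooth_at f)); try now apply smooth_at_continuity.
      now apply smooth_at_locally.
    - apply locally_2d_and; now apply smooth_at_locally. }
  assert (H : forall n g u v, P g u v -> ex_diff_n (fun u v => g (a u v) (b u v)) n u v).
  { intros n; induction n as [|n IH]; intros f u v (Hf & Ha & Hb).
    - split; [|exact I].
      apply continuity_2d_pt_comp; now apply smooth_at_continuity.
    - assert (Hloc : forall f, smooth_at f (a u v) (b u v) ->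
        locally_2d (ex_diff_n (fun u v => f (a u v) (b u v)) n) u v).
      { intros h Hh; eapply locally_2d_mono; [|exact (HP h u v (conj Hh (conj Ha Hb)))].
        intros p q; apply IH. }
      assert (Hloc' : forall f h, smooth_at f (a u v) (b u v) -> smooth_at h u v ->
        locally_2d (ex_diff_n (fun u v => f (a u v) (b u v) * h u v) n) u v).
      { intros h l Hh Hl.
        eapply locally_2d_mono_strong;
          [|exact (locally_2d_and _ _ _ _ (Hloc h Hh) (smooth_at_ex_diff_n l n _ _ Hl))].
        intros p q K; apply ex_diff_n_mult; eapply locally_2d_mono; try exact K;
          intros ? ? M; apply M. }
      apply ex_diff_n_S_iff; repeat split.
      + apply continuity_2d_pt_comp; now apply smooth_at_continuity.
      + eexists; now apply smooth_at_comp_is_derive1.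
      + eexists; now apply smooth_at_comp_is_derive2.
      + apply ex_diff_n_ext_loc with (fun u v =>
          D1 f (a u v) (b u v) * D1 a u v + D2 f (a u v) (b u v) * D1 b u v).
        * eapply locally_2d_mono; [|exact (HP f u v (conj Hf (conj Ha Hb)))].
          intros p q (K1 & K2 & K3); symmetry; apply is_derive_unique.
          now apply smooth_at_comp_is_derive1.
        * apply ex_diff_n_plus; apply Hloc';
            auto using smooth_at_D1, smooth_at_D2.
      + apply ex_diff_n_ext_loc with (fun u v =>
          D1 f (a u v) (b u v) * D2 a u v + D2 f (a u v) (b u v) * D2 b u v).
        * eapply locally_2d_mono; [|exact (HP f u v (conj Hf (conj Ha Hb)))].
          intros p q (K1 & K2 & K3); symmetry; apply is_derive_unique.
          now apply smooth_at_comp_is_derive2.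
        * apply ex_diff_n_plus; apply Hloc';
            auto using smooth_at_D1, smooth_at_D2. }
  intros Hg Ha Hb.
  eapply locally_2d_mono; [|exact (HP g x y (conj Hg (conj Ha Hb)))].
  intros u v K n; now apply H.
Qed.

(** * Bump functions *)

Lemma exp_INR_mult n z : exp (INR n * z) = exp z ^ n.
Proof.
  induction n as [|n IH].
  - now rewrite Rmult_0_l, exp_0.
  - rewrite S_INR, Rmult_plus_distr_r, Rmult_1_l, exp_plus, IH; simpl; ring.
Qed.

(* [x^(-m) exp(-1/x)]: the span of this family is closed under differentiation. *)
Definition flat (m : nat) (x : R) : R :=
  if Rlt_dec 0 x then (/ x) ^ m * exp (- / x) else 0.

Lemma flat_pos m x : 0 < x -> 0 < flat m x.
Proof.
  intros Hx; unfold flat; destruct (Rlt_dec 0 x) as [H|H]; [|lra].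
  apply Rmult_lt_0_compat; [apply pow_lt, Rinv_0_lt_compat, Hx | apply exp_pos].
Qed.

Lemma flat_neg m x : x <= 0 -> flat m x = 0.
Proof. intros Hx; unfold flat; destruct (Rlt_dec 0 x); lra. Qed.

Lemma flat_nonneg m x : 0 <= flat m x.
Proof.
  destruct (Rlt_dec 0 x) as [H|H].
  - now apply Rlt_le, flat_pos.
  - rewrite flat_neg; lra.
Qed.

(** With [z = y / m], the bound [z <= exp z] raised to the power [m] gives [z ^ m <= exp y]. *)
Lemma pow_le_exp m y : 0 <= y -> y ^ m <= INR m ^ m * exp y.
Proof.
  intros Hy; destruct m as [|m].
  - simpl; generalize (exp_ineq1_le y); lra.
  - set (z := y / INR (S m)).
    assert (Hm : 0 < INR (S m)) by apply lt_0_INR, Nat.lt_0_succ.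
    assert (Hz : y = INR (S m) * z) by (unfold z; field; lra).
    assert (0 <= z) by (apply Rdiv_le_0_compat; lra).
    rewrite Hz, exp_INR_mult, <- Rpow_mult_distr.
    apply pow_incr; split; [apply Rmult_le_pos; lra|].
    apply Rmult_le_compat_l; [lra|].
    generalize (exp_ineq1_le z); lra.
Qed.

(** This turns the difference quotient of [flat m] at 0 into [flat (S m)]. *)
Lemma flat_succ m x : flat m x = x * flat (S m) x.
Proof.
  unfold flat; destruct (Rlt_dec 0 x) as [H|H]; [simpl; field; lra | ring].
Qed.

(** [pow_le_exp] at [1/x] with exponent [m + 1] bounds [flat (S m)] by a constant; the spare factor
    [x] then forces decay to 0 at the origin. *)
Lemma flat_le m x : flat m x <= INR (S m) ^ S m * Rabs x.
Proof.
  unfold flat; destruct (Rlt_dec 0 x) as [H|H].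
  - rewrite (Rabs_pos_eq x) by lra.
    assert (Hi : 0 < / x) by now apply Rinv_0_lt_compat.
    pose proof (pow_le_exp (S m) (/ x) (Rlt_le _ _ Hi)) as Hp.
    rewrite exp_Ropp; pose proof (exp_pos (/ x)).
    apply Rmult_le_reg_r with (exp (/ x) * / x).
    + now apply Rmult_lt_0_compat.
    + replace ((/ x) ^ m * / exp (/ x) * (exp (/ x) * / x)) with ((/ x) ^ S m)
        by (simpl; field; lra).
      eapply Rle_trans; [exact Hp|]; right; field; lra.
  - apply Rmult_le_pos; [apply pow_le, pos_INR | apply Rabs_pos].
Qed.

Lemma is_derive_flat m x :
  is_derive (flat m) x (- INR m * flat (S m) x + flat (S (S m)) x).
Proof.
  destruct (Rtotal_order x 0) as [H|[H|H]].
  - rewrite !flat_neg by lra; rewrite Rmult_0_r, Rplus_0_l.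
    apply is_derive_ext_loc with (fun _ => 0).
    + apply (locally_interval _ x m_infty 0); simpl; trivial.
      intros y _ Hy; rewrite flat_neg; lra.
    + apply (is_derive_const (V := R_NormedModule) 0).
  - subst x; rewrite !flat_neg by lra; rewrite Rmult_0_r, Rplus_0_l.
    apply is_derive_Reals; intros eps Heps.
    set (C := INR (S (S m)) ^ S (S m)).
    assert (HC : 0 <= C) by apply pow_le, pos_INR.
    (* The [+ 1] keeps the denominator positive when only [0 <= C] is at hand. *)
    assert (Hd : 0 < eps / (C + 1)) by (apply Rdiv_lt_0_compat; lra).
    exists (mkposreal _ Hd); simpl; intros h Hh Hlt.
    rewrite Rplus_0_l, (flat_neg m 0) by lra; rewrite (flat_succ m h).
    replace ((h * flat (S m) h - 0) / h - 0) with (flat (S m) h) by now field.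
    rewrite Rabs_pos_eq by apply flat_nonneg.
    eapply Rle_lt_trans; [apply flat_le|]; fold C.
    apply Rle_lt_trans with ((C + 1) * Rabs h).
    + apply Rmult_le_compat_r; [apply Rabs_pos | lra].
    + apply Rmult_lt_compat_l with (r := C + 1) in Hlt; [|lra].
      replace ((C + 1) * (eps / (C + 1))) with eps in Hlt by (field; lra); exact Hlt.
  - apply is_derive_ext_loc with (fun x => (/ x) ^ m * exp (- / x)).
    + apply (locally_interval _ x 0 p_infty); simpl; trivial.
      intros y Hy _; unfold flat; destruct (Rlt_dec 0 y); [reflexivity | lra].
    + unfold flat; destruct (Rlt_dec 0 x) as [_|]; [|lra].
      auto_derive; [lra|].
      destruct m as [|m]; simpl; field; lra.
Qed.

(** The induction on the order runs over all [m] at once, since differentiating raises the index by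
    one and two. The dummy second variable makes [smooth_at_comp] applicable to one-variable
    functions. *)
Lemma ex_diff_n_flat n m x y : ex_diff_n (fun u _ => flat m u) n x y.
Proof.
  revert m x y; induction n as [|n IH]; intros m x y.
  - split; [|exact I].
    apply (continuity_1d_2d_pt_comp (flat m) (fun u _ => u)).
    + apply continuity_pt_filterlim, (ex_derive_continuous (V := R_NormedModule)).
      eexists; apply is_derive_flat.
    + apply continuity_2d_pt_id1.
  - apply ex_diff_n_S_iff; repeat split.
    + apply (ex_diff_n_continuity _ n), IH.
    + eexists; apply is_derive_flat.
    + apply ex_derive_const.
    + apply ex_diff_n_ext_loc with
        (fun u _ => - INR m * flat (S m) u + flat (S (S m)) u).
      * apply locally_2d_forall; intros u v; symmetry.
        apply is_derive_unique, is_derive_flat.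
      * apply ex_diff_n_plus; [|now apply locally_2d_forall].
        apply locally_2d_forall; intros u v.
        apply ex_diff_n_mult; [|now apply locally_2d_forall].
        apply locally_2d_forall; intros; apply ex_diff_n_const.
    + apply ex_diff_n_ext_loc with (fun _ _ => 0); [|apply ex_diff_n_const].
      apply locally_2d_forall; intros u v; unfold D2; now rewrite Derive_const.
Qed.

Lemma smooth_at_fst x y : smooth_at (fun u _ => u) x y.
Proof.
  apply locally_2d_forall; intros u v [|n].
  - split; [apply continuity_2d_pt_id1 | exact I].
  - apply ex_diff_n_S_iff; repeat split.
    + apply continuity_2d_pt_id1.
    + apply ex_derive_id.
    + apply ex_derive_const.
    + apply ex_diff_n_ext_loc with (fun _ _ => 1); [|apply ex_diff_n_const].
      apply locally_2d_forall; intros; unfold D1; now rewrite Derive_id.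
    + apply ex_diff_n_ext_loc with (fun _ _ => 0); [|apply ex_diff_n_const].
      apply locally_2d_forall; intros; unfold D2; now rewrite Derive_const.
Qed.

Lemma smooth_at_snd x y : smooth_at (fun _ v => v) x y.
Proof.
  apply locally_2d_forall; intros u v [|n].
  - split; [apply continuity_2d_pt_id2 | exact I].
  - apply ex_diff_n_S_iff; repeat split.
    + apply continuity_2d_pt_id2.
    + apply ex_derive_const.
    + apply ex_derive_id.
    + apply ex_diff_n_ext_loc with (fun _ _ => 0); [|apply ex_diff_n_const].
      apply locally_2d_forall; intros; unfold D1; now rewrite Derive_const.
    + apply ex_diff_n_ext_loc with (fun _ _ => 1); [|apply ex_diff_n_const].
      apply locally_2d_forall; intros; unfold D2; now rewrite Derive_id.
Qed.

Lemma smooth_at_flat f x y : smooth_at f x y -> smooth_at (fun u v => flat 0 (f u v)) x y.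
Proof.
  intros Hf; apply (smooth_at_comp (fun u _ => flat 0 u) f f); trivial.
  apply locally_2d_forall; intros u v n; apply ex_diff_n_flat.
Qed.

(** Each factor switches off one side of the square of half-width [r] centred at [(x0, t0)]. *)
Definition bump (r x0 t0 x t : R) : R :=
  flat 0 (r - (x - x0)) * flat 0 (r - (x0 - x)) *
  (flat 0 (r - (t - t0)) * flat 0 (r - (t0 - t))).

Lemma smooth_at_bump r x0 t0 x t : smooth_at (bump r x0 t0) x t.
Proof.
  repeat apply smooth_at_mult; apply smooth_at_flat;
    repeat apply smooth_at_minus;
    apply smooth_at_const || apply smooth_at_fst || apply smooth_at_snd.
Qed.

Lemma bump_nonneg r x0 t0 x t : 0 <= bump r x0 t0 x t.
Proof. repeat apply Rmult_le_pos; apply flat_nonneg. Qed.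

Lemma bump_pos r x0 t0 x t :
  Rabs (x - x0) < r -> Rabs (t - t0) < r -> 0 < bump r x0 t0 x t.
Proof.
  intros Hx Ht; apply Rabs_def2 in Hx; apply Rabs_def2 in Ht.
  repeat apply Rmult_lt_0_compat; apply flat_pos; lra.
Qed.

Lemma bump_eq_0 r x0 t0 x t :
  ~ (x0 - r <= x <= x0 + r /\ t0 - r <= t <= t0 + r) -> bump r x0 t0 x t = 0.
Proof.
  intros H; unfold bump.
  destruct (Rle_dec (r - (x - x0)) 0) as [H1|H1]; [rewrite (flat_neg _ _ H1); ring|].
  destruct (Rle_dec (r - (x0 - x)) 0) as [H2|H2]; [rewrite (flat_neg _ _ H2); ring|].
  destruct (Rle_dec (r - (t - t0)) 0) as [H3|H3]; [rewrite (flat_neg _ _ H3); ring|].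
  destruct (Rle_dec (r - (t0 - t)) 0) as [H4|H4]; [rewrite (flat_neg _ _ H4); ring|].
  exfalso; apply H; lra.
Qed.

(** * Iterated integrals over a rectangle *)

Lemma RInt_ge_of_subinterval f a b c d eta :
  a <= c -> c <= d -> d <= b -> ex_RInt f a b ->
  (forall x, a < x < b -> 0 <= f x) -> (forall x, c < x < d -> eta <= f x) ->
  eta * (d - c) <= RInt f a b.
Proof.
  intros Hac Hcd Hdb Hf H0 Heta.
  assert (Hac' : ex_RInt f a c) by (apply (ex_RInt_Chasles_1 (V := R_CompleteNormedModule)) with b; [lra | exact Hf]).
  assert (Hcb : ex_RInt f c b) by (apply (ex_RInt_Chasles_2 (V := R_CompleteNormedModule)) with a; [lra | exact Hf]).
  assert (Hcd' : ex_RInt f c d) by (apply (ex_RInt_Chasles_1 (V := R_CompleteNormedModule)) with b; [lra | exact Hcb]).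
  assert (Hdb' : ex_RInt f d b) by (apply (ex_RInt_Chasles_2 (V := R_CompleteNormedModule)) with c; [lra | exact Hcb]).
  rewrite <- (RInt_Chasles (V := R_CompleteNormedModule) f a c b), <- (RInt_Chasles (V := R_CompleteNormedModule) f c d b) by trivial.
  unfold plus; simpl.
  assert (0 <= RInt f a c) by (apply RInt_ge_0; trivial; intros; apply H0; lra).
  assert (0 <= RInt f d b) by (apply RInt_ge_0; trivial; intros; apply H0; lra).
  assert (RInt (fun _ => eta) c d <= RInt f c d).
  { apply RInt_le; trivial; apply ex_RInt_const. }
  rewrite RInt_const in H2; unfold scal in H2; simpl in H2; unfold mult in H2; simpl in H2.
  lra.
Qed.

(** Continuity is two-sided even on the boundary, as for restrictions of functions continuous on a
    neighbourhood. *)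
Definition continuous_on_rectangle (a b c d : R) (f : R -> R -> R) : Prop :=
  forall x t, a <= x <= b -> c <= t <= d -> continuity_2d_pt f x t.

Lemma continuity_2d_pt_section1 f x t :
  continuity_2d_pt f x t -> continuous (fun x => f x t) x.
Proof.
  intros H; apply continuity_pt_filterlim; intros eps Heps.
  destruct (H (mkposreal _ Heps)) as [del Hdel].
  exists del; split; [apply cond_pos|].
  intros y [_ Hy]; apply (Hdel y t); [exact Hy|].
  rewrite Rminus_diag, Rabs_R0; apply cond_pos.
Qed.

Lemma ex_RInt_inner a b c d f t :
  a <= b -> continuous_on_rectangle a b c d f -> c <= t <= d ->
  ex_RInt (fun x => f x t) a b.
Proof.
  intros Hab Hf Ht; apply (ex_RInt_continuous (V := R_CompleteNormedModule)).
  rewrite Rmin_left, Rmax_right by lra; intros x Hx.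
  now apply (continuity_2d_pt_section1 f), Hf.
Qed.

(** Uniform continuity of [f] on the rectangle makes the inner integral a continuous function of
    [t]. *)
Lemma ex_RInt_outer a b c d f :
  a <= b -> c <= d -> continuous_on_rectangle a b c d f ->
  ex_RInt (fun t => RInt (fun x => f x t) a b) c d.
Proof.
  intros Hab Hcd Hf.
  (* The inner integral need not exist for [t] outside [c, d]. *)
  set (clamp t := Rmax c (Rmin d t)).
  assert (Hclamp : forall t, c <= clamp t <= d).
  { intros t; unfold clamp, Rmax, Rmin.
    destruct (Rle_dec d t); destruct (Rle_dec c _); lra. }
  assert (Hlip : forall t t', Rabs (clamp t - clamp t') <= Rabs (t - t')).
  { intros t t'; unfold clamp, Rmax, Rmin.
    destruct (Rle_dec d t); destruct (Rle_dec d t');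
      repeat destruct (Rle_dec c _); split_Rabs; lra. }
  apply ex_RInt_ext with (fun t => RInt (fun x => f x (clamp t)) a b).
  { rewrite Rmin_left, Rmax_right by lra; intros t Ht.
    replace (clamp t) with t; [reflexivity|].
    unfold clamp, Rmax, Rmin; destruct (Rle_dec d t); destruct (Rle_dec c _); lra. }
  apply (ex_RInt_continuous (V := R_CompleteNormedModule)); intros t0 _.
  apply continuity_pt_filterlim; intros eps Heps.
  (* Dividing by [b - a + 1] also covers the degenerate case [a = b] and makes the final inequality
     strict. *)
  assert (He : 0 < eps / (b - a + 1)) by (apply Rdiv_lt_0_compat; lra).
  destruct (uniform_continuity_2d f a b c d Hf (mkposreal _ He)) as [del Hdel].
  simpl in Hdel; exists del; split; [apply cond_pos|].
  intros t [_ Ht]; simpl in *; unfold R_dist in *.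
  assert (Hex : forall t, ex_RInt (fun x => f x (clamp t)) a b)
    by (intros t'; apply (ex_RInt_inner a b c d); auto).
  apply Rle_lt_trans with (Rabs (RInt (fun x => f x (clamp t) - f x (clamp t0)) a b)).
  { right; f_equal; symmetry.
    apply (RInt_minus (V := R_CompleteNormedModule)); apply Hex. }
  eapply Rle_lt_trans.
  - apply (abs_RInt_le_const _ a b (eps / (b - a + 1))); [exact Hab| |].
    + apply (ex_RInt_minus (V := R_NormedModule)); apply Hex.
    + intros x Hx; apply Rlt_le, Hdel; auto.
      * rewrite Rminus_diag, Rabs_R0; apply cond_pos.
      * eapply Rle_lt_trans; [apply Hlip | exact Ht].
  - apply Rlt_le_trans with ((b - a + 1) * (eps / (b - a + 1))).
    + apply Rmult_lt_compat_r; lra.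
    + right; field; lra.
Qed.

Definition RInt2 (a b c d : R) (f : R -> R -> R) : R :=
  RInt (fun t => RInt (fun x => f x t) a b) c d.

(** By continuity [f] exceeds half its value at [(x0, t0)] on a small square inside the rectangle.
    [RInt_ge_of_subinterval], used once per variable, bounds the integral below by that half times
    the area of the square. *)
Lemma RInt2_pos a b c d f x0 t0 :
  a < x0 < b -> c < t0 < d -> continuous_on_rectangle a b c d f ->
  (forall x t, a < x < b -> c < t < d -> 0 <= f x t) ->
  0 < f x0 t0 -> 0 < RInt2 a b c d f.
Proof.
  intros Hx0 Ht0 Hf H0 Hpos; unfold RInt2.
  assert (Heta : 0 < f x0 t0 / 2) by lra.
  destruct (Hf x0 t0 ltac:(lra) ltac:(lra) (mkposreal _ Heta)) as [del Hdel].
  simpl in Hdel; pose proof (cond_pos del) as Hdelpos.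
  set (r := Rmin del (Rmin (Rmin (x0 - a) (b - x0)) (Rmin (t0 - c) (d - t0)))).
  assert (Hr : 0 < r) by (repeat apply Rmin_glb_lt; lra).
  assert (Hrle : r <= del /\ r <= x0 - a /\ r <= b - x0 /\ r <= t0 - c /\ r <= d - t0).
  { clear; unfold r, Rmin; repeat destruct (Rle_dec _ _); lra. }
  assert (Hex : forall t, c <= t <= d -> ex_RInt (fun x => f x t) a b)
    by (intros t Ht; apply (ex_RInt_inner a b c d); trivial; lra).
  apply Rlt_le_trans with
    (f x0 t0 / 2 * (x0 + r - (x0 - r)) * (t0 + r - (t0 - r))).
  { repeat apply Rmult_lt_0_compat; lra. }
  apply RInt_ge_of_subinterval; try lra.
  - apply ex_RInt_outer; trivial; lra.
  - intros t Ht; apply RInt_ge_0; [lra | apply Hex; lra |].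
    intros x Hx; now apply H0.
  - intros t Ht; apply RInt_ge_of_subinterval; try lra.
    + apply Hex; lra.
    + intros x Hx; apply H0; lra.
    + intros x Hx; specialize (Hdel x t ltac:(apply Rabs_def1; lra) ltac:(apply Rabs_def1; lra)).
      apply Rabs_def2 in Hdel; lra.
Qed.

Lemma RInt2_ext a b c d f g :
  a <= b -> c <= d ->
  (forall x t, a < x < b -> c < t < d -> f x t = g x t) ->
  RInt2 a b c d f = RInt2 a b c d g.
Proof.
  intros Hab Hcd H; apply RInt_ext; rewrite Rmin_left, Rmax_right by lra.
  intros t Ht; apply RInt_ext; rewrite Rmin_left, Rmax_right by lra.
  intros x Hx; now apply H.
Qed.

(** The shape [f + k * g] can be nested, so this one rule splits both the polynomial in [eps] and
    the integration by parts identity. *)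
Lemma RInt2_plus_scal a b c d k f g :
  a <= b -> c <= d ->
  continuous_on_rectangle a b c d f -> continuous_on_rectangle a b c d g ->
  RInt2 a b c d (fun x t => f x t + k * g x t) =
  RInt2 a b c d f + k * RInt2 a b c d g.
Proof.
  intros Hab Hcd Hf Hg; unfold RInt2.
  transitivity
    (RInt (fun t => RInt (fun x => f x t) a b + k * RInt (fun x => g x t) a b) c d).
  - apply RInt_ext; rewrite Rmin_left, Rmax_right by lra; intros t Ht.
    assert (Ef : ex_RInt (fun x => f x t) a b) by (apply (ex_RInt_inner a b c d); trivial; lra).
    assert (Eg : ex_RInt (fun x => g x t) a b) by (apply (ex_RInt_inner a b c d); trivial; lra).
    apply is_RInt_unique.
    apply (is_RInt_plus (V := R_NormedModule)).
    + now apply (RInt_correct (V := R_CompleteNormedModule)).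
    + apply (is_RInt_scal (V := R_NormedModule)).
      now apply (RInt_correct (V := R_CompleteNormedModule)).
  - apply is_RInt_unique.
    apply (is_RInt_plus (V := R_NormedModule)).
    + now apply (RInt_correct (V := R_CompleteNormedModule)), ex_RInt_outer.
    + apply (is_RInt_scal (V := R_NormedModule)).
      now apply (RInt_correct (V := R_CompleteNormedModule)), ex_RInt_outer.
Qed.

Lemma continuity_2d_pt_swap f x y :
  continuity_2d_pt f x y -> continuity_2d_pt (fun u v => f v u) y x.
Proof.
  intros H eps; destruct (H eps) as [del Hdel]; exists del; auto.
Qed.

Lemma is_derive_RInt_section F a b t :
  a <= b -> (forall x t, a <= x <= b -> smooth_at F x t) ->
  is_derive (fun t => RInt (fun x => F x t) a b) t (RInt (fun x => D2 F x t) a b).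
Proof.
  intros Hab HF.
  apply (is_derive_RInt_param (fun t x => F x t));
    rewrite ?Rmin_left, ?Rmax_right by lra.
  - apply filter_forall; intros t' x Hx; now apply smooth_at_ex_derive2, HF.
  - intros x Hx.
    apply (continuity_2d_pt_swap (D2 F)), smooth_at_continuity, smooth_at_D2; now apply HF.
  - apply filter_forall; intros t'.
    apply (ex_RInt_inner a b t' t'); [exact Hab | | lra].
    intros x t'' Hx _; now apply smooth_at_continuity, HF.
Qed.

(** The inner integral of [D2 F] is the [t]-derivative of the inner integral of [F], which vanishes
    at [c] and [d]. Its continuity comes from applying the same differentiation rule to [D2 F]. *)
Lemma RInt2_D2_eq_0 F a b c d :
  a <= b -> c <= d -> (forall x t, a <= x <= b -> smooth_at F x t) ->
  (forall x, F x c = 0) -> (forall x, F x d = 0) ->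
  RInt2 a b c d (D2 F) = 0.
Proof.
  intros Hab Hcd HF Hc Hd; unfold RInt2.
  rewrite (is_RInt_unique _ c d _
    (is_RInt_derive (fun t => RInt (fun x => F x t) a b) _ c d
      (fun t _ => is_derive_RInt_section F a b t Hab HF)
      (fun t _ => ex_derive_continuous _ _ (ex_intro _ _
         (is_derive_RInt_section (D2 F) a b t Hab
           (fun x t Hx => smooth_at_D2 _ _ _ (HF x t Hx))))))).
  rewrite (RInt_ext (fun x => F x c) (fun _ => 0)) by (intros; apply Hc).
  rewrite (RInt_ext (fun x => F x d) (fun _ => 0)) by (intros; apply Hd).
  apply (minus_eq_zero (G := R_AbelianGroup)).
Qed.

Lemma RInt2_D1_eq_0 F a b c d :
  a <= b -> c <= d ->
  (forall x t, a <= x <= b -> c <= t <= d -> smooth_at F x t) ->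
  (forall t, F a t = 0) -> (forall t, F b t = 0) ->
  RInt2 a b c d (D1 F) = 0.
Proof.
  intros Hab Hcd HF Ha Hb; unfold RInt2.
  rewrite (RInt_ext _ (fun _ => 0)).
  { rewrite RInt_const; apply (scal_zero_r (V := R_NormedModule)). }
  rewrite Rmin_left, Rmax_right by lra; intros t Ht.
  transitivity (F b t - F a t); [|rewrite Ha, Hb; apply Rminus_diag].
  apply (RInt_Derive (fun x => F x t)); rewrite Rmin_left, Rmax_right by lra; intros x Hx.
  - apply smooth_at_ex_derive1, HF; lra.
  - apply (continuity_2d_pt_section1 (D1 F)), smooth_at_continuity, smooth_at_D1, HF; lra.
Qed.

(** * The action and its first variation *)

Lemma RInt2_0 a b c d : RInt2 a b c d (fun _ _ => 0) = 0.
Proof.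
  unfold RInt2; rewrite (RInt_ext _ (fun _ => 0));
    intros; rewrite RInt_const; apply (scal_zero_r (V := R_NormedModule)).
Qed.

Lemma fundamental_lemma_calculus_of_variations a b tau E :
  a < b -> 0 < tau -> continuous_on_rectangle a b 0 tau E ->
  (forall phi, smooth_on plane phi -> compactly_supported a b tau phi ->
     RInt2 a b 0 tau (fun x t => E x t * phi x t) = 0) ->
  forall x t, cylinder a b tau x t -> E x t = 0.
Proof.
  intros Hab Htau HE Hweak x0 t0 [Hx0 Ht0].
  destruct (Req_dec (E x0 t0) 0) as [H0|H0]; [exact H0 | exfalso].
  set (E0 := E x0 t0) in *.
  assert (Hsq : 0 < E0 * E0) by nra.
  (* Continuity of [E * E0] with tolerance [E0 * E0] keeps that product positive near the point.
     Scaling the bump by [E0] thus avoids a case split on the sign of [E0]. *)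
  destruct (continuity_2d_pt_mult E (fun _ _ => E0) x0 t0
    (HE x0 t0 ltac:(lra) ltac:(lra)) (continuity_2d_pt_const x0 t0 E0)
    (mkposreal _ Hsq)) as [del Hdel].
  fold E0 in Hdel; simpl in Hdel; pose proof (cond_pos del) as Hdelpos.
  set (m := Rmin del (Rmin (Rmin (x0 - a) (b - x0)) (Rmin t0 (tau - t0)))).
  assert (Hm : 0 < m) by (repeat apply Rmin_glb_lt; lra).
  assert (Hmle : m <= del /\ m <= x0 - a /\ m <= b - x0 /\ m <= t0 /\ m <= tau - t0).
  { clear; unfold m, Rmin; repeat destruct (Rle_dec _ _); lra. }
  (* The closed square of half-width [r] must lie in the open cylinder and within the region of
     positivity, hence [r] strictly below [m]. *)
  set (r := m / 2); assert (Hr : 0 < r < m) by (unfold r; lra).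
  set (phi x t := E0 * bump r x0 t0 x t).
  assert (Hphi : forall x t, smooth_at phi x t)
    by (intros; apply smooth_at_scal, smooth_at_bump).
  assert (Hpos : 0 < RInt2 a b 0 tau (fun x t => E x t * phi x t)).
  { apply RInt2_pos with x0 t0; trivial.
    - intros x t Hx Ht; apply continuity_2d_pt_mult; [now apply HE|].
      apply smooth_at_continuity, Hphi.
    - intros x t Hx Ht; unfold phi; rewrite <- Rmult_assoc.
      destruct (Rlt_dec (Rabs (x - x0)) m) as [H1|H1];
        [destruct (Rlt_dec (Rabs (t - t0)) m) as [H2|H2]|].
      + apply Rmult_le_pos; [|apply bump_nonneg].
        specialize (Hdel x t ltac:(lra) ltac:(lra)); apply Rabs_def2 in Hdel; lra.
      + rewrite bump_eq_0; [lra|]; intros [_ K]; apply H2, Rabs_def1; lra.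
      + rewrite bump_eq_0; [lra|]; intros [K _]; apply H1, Rabs_def1; lra.
    - unfold phi; fold E0; rewrite <- Rmult_assoc; apply Rmult_lt_0_compat; trivial.
      apply bump_pos; rewrite Rminus_diag, Rabs_R0; lra. }
  rewrite Hweak in Hpos; [lra | intros x t _; apply Hphi |].
  exists (x0 - r), (x0 + r), (t0 - r), (t0 + r); repeat split; try lra.
  intros x t H; unfold phi; rewrite bump_eq_0 by exact H; ring.
Qed.

Lemma is_derive_quadratic_0 p q r :
  is_derive (fun eps => p + eps * q + eps ^ 2 * r) 0 q.
Proof. auto_derive; [trivial | ring]. Qed.

(** For the actual coefficients this is convertible to [lhs] in the final theorem; the variational
    part treats arbitrary smooth [c] and [D]. *)
Definition wave_operator (rho0 : R) (c D J : R -> R -> R) (x t : R) : R :=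
  rho0 * D2 (D2 J) x t - D1 (fun x' t' => c x' t' * D1 J x' t') x t - D1 D x t.

(** The coefficient of [eps] in the density along [J + eps * phi]. *)
Definition first_variation (rho0 : R) (c D J phi : R -> R -> R) (x t : R) : R :=
  rho0 * (D2 J x t * D2 phi x t) - c x t * D1 J x t * D1 phi x t - D x t * D1 phi x t.

Section FirstVariation.

Variables (a b tau rho0 : R) (c D J : R -> R -> R).
Hypotheses (Hab : a < b) (Htau : 0 < tau).
Hypothesis Hc : smooth_on (closed_cylinder a b tau) c.
Hypothesis HD : smooth_on (closed_cylinder a b tau) D.
Hypothesis HJ : smooth_on (closed_cylinder a b tau) J.

Let L := energy_density rho0 c D.

Lemma smooth_at_flux x t : closed_cylinder a b tau x t ->
  smooth_at (fun x t => c x t * D1 J x t) x t.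
Proof.
  intros K; apply smooth_at_mult; [now apply Hc | now apply smooth_at_D1, HJ].
Qed.

Lemma continuous_wave_operator :
  continuous_on_rectangle a b 0 tau (wave_operator rho0 c D J).
Proof.
  intros x t Hx Ht; pose proof (conj Hx Ht : closed_cylinder a b tau x t) as K.
  apply smooth_at_continuity; repeat apply smooth_at_minus.
  - now apply smooth_at_scal, smooth_at_D2, smooth_at_D2, HJ.
  - now apply smooth_at_D1, smooth_at_flux.
  - now apply smooth_at_D1, HD.
Qed.

Lemma euler_lagrange_energy_density x t : closed_cylinder a b tau x t ->
  euler_lagrange L J x t = wave_operator rho0 c D J x t.
Proof.
  intros K; unfold euler_lagrange, wave_operator, L, energy_density.
  rewrite Derive_const.
  assert (E2 : D2 (fun x' t' => Derive (fun a =>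
    rho0 / 2 * a ^ 2 - c x' t' / 2 * D1 J x' t' ^ 2 - D x' t' * D1 J x' t')
    (D2 J x' t')) x t = rho0 * D2 (D2 J) x t).
  { transitivity (Derive (fun z => rho0 * D2 J x z) t); [|apply Derive_scal].
    apply Derive_ext; intros z.
    apply is_derive_unique; auto_derive; [trivial | field]. }
  assert (E1 : D1 (fun x' t' => Derive (fun b =>
    rho0 / 2 * D2 J x' t' ^ 2 - c x' t' / 2 * b ^ 2 - D x' t' * b)
    (D1 J x' t')) x t =
    - (D1 (fun x t => c x t * D1 J x t) x t + D1 D x t)).
  { transitivity (Derive (fun z => - (c z t * D1 J z t + D z t)) x).
    - apply Derive_ext; intros z.
      apply is_derive_unique; auto_derive; [trivial | field].
    - rewrite Derive_opp, Derive_plus; [reflexivity | |].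
      + now apply (smooth_at_ex_derive1 (fun x t => c x t * D1 J x t)), smooth_at_flux.
      + now apply smooth_at_ex_derive1, HD. }
  rewrite E1, E2; ring.
Qed.

Variable phi : R -> R -> R.
Hypothesis Hphi : smooth_on plane phi.

Lemma is_derive_action :
  is_derive (fun eps => action L a b tau (fun x t => J x t + eps * phi x t)) 0
    (RInt2 a b 0 tau (first_variation rho0 c D J phi)).
Proof.
  assert (Hs : forall x t, smooth_at phi x t) by (intros; now apply Hphi).
  (* [f0] and [f2] are the coefficients of [eps ^ 0] and [eps ^ 2]. Squares are spelled as products
     so that the smoothness rules apply. *)
  set (f0 x t := rho0 / 2 * (D2 J x t * D2 J x t)
    - / 2 * (c x t * D1 J x t * D1 J x t) - D x t * D1 J x t).
  set (f2 x t := rho0 / 2 * (D2 phi x t * D2 phi x t)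
    - / 2 * (c x t * (D1 phi x t * D1 phi x t))).
  assert (C0 : continuous_on_rectangle a b 0 tau f0).
  { intros x t Hx Ht; pose proof (conj Hx Ht : closed_cylinder a b tau x t) as K.
    pose proof (HJ x t K : smooth_at J x t) as SJ.
    pose proof (Hc x t K : smooth_at c x t) as Sc.
    pose proof (HD x t K : smooth_at D x t) as SD.
    apply smooth_at_continuity; unfold f0;
      repeat (apply smooth_at_minus || apply smooth_at_scal || apply smooth_at_mult);
      auto using smooth_at_D1, smooth_at_D2. }
  assert (C1 : continuous_on_rectangle a b 0 tau (first_variation rho0 c D J phi)).
  { intros x t Hx Ht; pose proof (conj Hx Ht : closed_cylinder a b tau x t) as K.
    pose proof (HJ x t K : smooth_at J x t) as SJ.
    pose proof (Hc x t K : smooth_at c x t) as Sc.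
    pose proof (HD x t K : smooth_at D x t) as SD.
    apply smooth_at_continuity; unfold first_variation;
      repeat (apply smooth_at_minus || apply smooth_at_scal || apply smooth_at_mult);
      auto using smooth_at_D1, smooth_at_D2. }
  assert (C2 : continuous_on_rectangle a b 0 tau f2).
  { intros x t Hx Ht; pose proof (conj Hx Ht : closed_cylinder a b tau x t) as K.
    pose proof (HJ x t K : smooth_at J x t) as SJ.
    pose proof (Hc x t K : smooth_at c x t) as Sc.
    pose proof (HD x t K : smooth_at D x t) as SD.
    apply smooth_at_continuity; unfold f2;
      repeat (apply smooth_at_minus || apply smooth_at_scal || apply smooth_at_mult);
      auto using smooth_at_D1, smooth_at_D2. }
  eapply is_derive_ext; [|apply is_derive_quadratic_0 with
    (p := RInt2 a b 0 tau f0) (r := RInt2 a b 0 tau f2)].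
  intros eps; symmetry.
  rewrite <- !RInt2_plus_scal; trivial; try lra.
  - apply RInt2_ext; try lra; intros x t Hx Ht.
    assert (K : closed_cylinder a b tau x t) by (split; lra).
    assert (E1 : D1 (fun x t => J x t + eps * phi x t) x t = D1 J x t + eps * D1 phi x t).
    { unfold D1; rewrite Derive_plus, Derive_scal; trivial.
      - now apply smooth_at_ex_derive1, HJ.
      - now apply (smooth_at_ex_derive1 (fun x t => eps * phi x t)), smooth_at_scal. }
    assert (E2 : D2 (fun x t => J x t + eps * phi x t) x t = D2 J x t + eps * D2 phi x t).
    { unfold D2; rewrite Derive_plus, Derive_scal; trivial.
      - now apply smooth_at_ex_derive2, HJ.
      - now apply (smooth_at_ex_derive2 (fun x t => eps * phi x t)), smooth_at_scal. }
    unfold L, energy_density; rewrite E1, E2; unfold f0, first_variation, f2; field.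
  - intros x t Hx Ht; apply continuity_2d_pt_plus; [now apply C0|].
    apply continuity_2d_pt_mult; [apply continuity_2d_pt_const | now apply C1].
Qed.

Hypothesis Hsupp : compactly_supported a b tau phi.

(* Integration by parts: the boundary terms are those of [rho0 J_t phi] in [t] and
   of [(c J_x + D) phi] in [x]. *)
Lemma RInt2_first_variation :
  RInt2 a b 0 tau (first_variation rho0 c D J phi) =
  - RInt2 a b 0 tau (fun x t => wave_operator rho0 c D J x t * phi x t).
Proof.
  destruct Hsupp as (b1 & b2 & t1 & t2 & H1 & _ & H2 & H3 & _ & H4 & H0).
  assert (Hs : forall x t, smooth_at phi x t) by (intros; now apply Hphi).
  set (P x t := D2 J x t * phi x t).
  set (W x t := (c x t * D1 J x t + D x t) * phi x t).
  (* [RInt2_D2_eq_0] asks for the whole strip in [t]. Outside [[0, tau]] nothing is known of [J],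
     but there [phi] vanishes on a neighbourhood, so [P] is locally zero. *)
  assert (HP : forall x t, a <= x <= b -> smooth_at P x t).
  { intros x t Hx; destruct (Rle_dec 0 t) as [T1|T1]; [destruct (Rle_dec t tau) as [T2|T2]|].
    - apply smooth_at_mult; [apply smooth_at_D2, HJ; split; lra | apply Hs].
    - apply smooth_at_ext_loc with (fun _ _ => 0); [|apply smooth_at_const].
      assert (Hd : 0 < t - tau) by lra.
      exists (mkposreal _ Hd); simpl; intros u v _ Hv; apply Rabs_def2 in Hv.
      unfold P; rewrite H0; [ring | intros [_ K]; lra].
    - apply smooth_at_ext_loc with (fun _ _ => 0); [|apply smooth_at_const].
      assert (Hd : 0 < - t) by lra.
      exists (mkposreal _ Hd); simpl; intros u v _ Hv; apply Rabs_def2 in Hv.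
      unfold P; rewrite H0; [ring | intros [_ K]; lra]. }
  assert (HW : forall x t, a <= x <= b -> 0 <= t <= tau -> smooth_at W x t).
  { intros x t Hx Ht; pose proof (conj Hx Ht : closed_cylinder a b tau x t) as K.
    apply smooth_at_mult; [apply smooth_at_plus|];
      [now apply smooth_at_flux | now apply HD | apply Hs]. }
  assert (Z2 : RInt2 a b 0 tau (D2 P) = 0).
  { apply RInt2_D2_eq_0; trivial; try lra;
      intros x; unfold P; rewrite H0; try ring; intros [_ K]; lra. }
  assert (Z1 : RInt2 a b 0 tau (D1 W) = 0).
  { apply RInt2_D1_eq_0; trivial; try lra;
      intros t; unfold W; rewrite H0; try ring; intros [K _]; lra. }
  assert (CP : continuous_on_rectangle a b 0 tau (D2 P))
    by (intros x t Hx Ht; now apply smooth_at_continuity, smooth_at_D2, HP).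
  assert (CW : continuous_on_rectangle a b 0 tau (D1 W))
    by (intros x t Hx Ht; now apply smooth_at_continuity, smooth_at_D1, HW).
  assert (CE : continuous_on_rectangle a b 0 tau (fun x t => wave_operator rho0 c D J x t * phi x t)).
  { intros x t Hx Ht; apply continuity_2d_pt_mult;
      [now apply continuous_wave_operator | apply smooth_at_continuity, Hs]. }
  assert (C0 : continuous_on_rectangle a b 0 tau (fun _ _ => 0))
    by (intros x t _ _; apply continuity_2d_pt_const).
  (* The product rule gives the identity [first_variation = rho0 * D2 P - D1 W - wave_operator *
     phi]. The leading 0 puts the sum in the nested form [f + k * g]. *)
  transitivity (RInt2 a b 0 tau (fun x t =>
    0 + rho0 * D2 P x t + (-1) * D1 W x t
    + (-1) * (wave_operator rho0 c D J x t * phi x t))).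
  - apply RInt2_ext; try lra; intros x t Hx Ht.
    assert (K : closed_cylinder a b tau x t) by (split; lra).
    assert (EP : D2 P x t = D2 (D2 J) x t * phi x t + D2 J x t * D2 phi x t).
    { apply Derive_mult.
      - now apply (smooth_at_ex_derive2 (D2 J)), smooth_at_D2, HJ.
      - apply smooth_at_ex_derive2, Hs. }
    assert (EW : D1 W x t =
      (D1 (fun x t => c x t * D1 J x t) x t + D1 D x t) * phi x t
      + (c x t * D1 J x t + D x t) * D1 phi x t).
    { pose proof (smooth_at_flux x t K) as F.
      unfold D1 at 1, W; rewrite Derive_mult, Derive_plus; [reflexivity| | | |].
      - now apply (smooth_at_ex_derive1 (fun x t => c x t * D1 J x t)).
      - now apply smooth_at_ex_derive1, HD.
      - apply (smooth_at_ex_derive1 (fun x t => c x t * D1 J x t + D x t)).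
        apply smooth_at_plus; [exact F | now apply HD].
      - apply smooth_at_ex_derive1, Hs. }
    rewrite EP, EW; unfold first_variation, wave_operator; ring.
  - assert (Cadd : forall k f g, continuous_on_rectangle a b 0 tau f ->
      continuous_on_rectangle a b 0 tau g ->
      continuous_on_rectangle a b 0 tau (fun x t => f x t + k * g x t)).
    { intros k f g Hf Hg x t Hx Ht; apply continuity_2d_pt_plus; [now apply Hf|].
      apply continuity_2d_pt_mult; [apply continuity_2d_pt_const | now apply Hg]. }
    rewrite !RInt2_plus_scal; auto; try lra.
    rewrite Z1, Z2.
    rewrite RInt2_0; ring.
Qed.

End FirstVariation.

Lemma stationary_iff_wave_operator_eq_0 a b tau rho0 c D J :
  a < b -> 0 < tau ->
  smooth_on (closed_cylinder a b tau) c -> smooth_on (closed_cylinder a b tau) D ->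
  smooth_on (closed_cylinder a b tau) J ->
  stationary (energy_density rho0 c D) a b tau J <->
  (forall x t, cylinder a b tau x t -> wave_operator rho0 c D J x t = 0).
Proof.
  intros Hab Htau Hc HD HJ; split.
  - intros Hstat.
    apply fundamental_lemma_calculus_of_variations; trivial.
    + now apply continuous_wave_operator.
    + intros phi Hphi Hsupp.
      pose proof (Hstat phi Hphi Hsupp) as H0.
      pose proof (is_derive_action a b tau rho0 c D J Hab Htau Hc HD HJ phi Hphi) as H1.
      (* Stationarity and [is_derive_action] give two values for the same derivative at 0. *)
      apply is_derive_unique in H0; apply is_derive_unique in H1.
      rewrite (RInt2_first_variation a b tau rho0 c D J Hab Htau Hc HD HJ phi Hphi Hsupp) in H1.
      pose proof (eq_trans (eq_sym H0) H1); lra.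
  - intros HE phi Hphi Hsupp.
    replace 0 with (RInt2 a b 0 tau (first_variation rho0 c D J phi)) at 2.
    + now apply is_derive_action.
    + rewrite RInt2_first_variation by trivial.
      rewrite (RInt2_ext _ _ _ _ _ (fun _ _ => 0)); try lra.
      * rewrite RInt2_0; ring.
      * intros x t Hx Ht; rewrite HE; [ring | split; lra].
Qed.

(** * The energy equation *)

Lemma cylinder_locally a b tau x t :
  cylinder a b tau x t -> locally_2d (cylinder a b tau) x t.
Proof.
  intros [Hx Ht].
  set (m := Rmin (Rmin (x - a) (b - x)) (Rmin t (tau - t))).
  assert (Hm : 0 < m) by (repeat apply Rmin_glb_lt; lra).
  assert (Hmle : m <= x - a /\ m <= b - x /\ m <= t /\ m <= tau - t).
  { clear; unfold m, Rmin; repeat destruct (Rle_dec _ _); lra. }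
  exists (mkposreal _ Hm); simpl; intros u v Hu Hv.
  apply Rabs_def2 in Hu; apply Rabs_def2 in Hv; split; lra.
Qed.

Lemma cylinder_closed a b tau x t : cylinder a b tau x t -> closed_cylinder a b tau x t.
Proof. intros [Hx Ht]; split; lra. Qed.

Section Motion.

Variables (rho0 k : R) (e u s : R -> R -> R).
Hypothesis He : smooth_on plane e.

Lemma smooth_on_stress : smooth_on plane (stress rho0 e).
Proof. intros p q _; now apply smooth_at_scal, smooth_at_D1, He. Qed.

Lemma smooth_on_temperature : smooth_on plane (temperature e).
Proof. intros p q _; now apply (smooth_at_D2 e), He. Qed.

Lemma smooth_at_along g x t :
  smooth_on plane g -> smooth_at u x t -> smooth_at s x t -> smooth_at (along g u s) x t.
Proof.
  intros Hg Hu Hs; apply (smooth_at_comp g (D1 u) s); trivial.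
  - now apply Hg.
  - now apply smooth_at_D1.
Qed.

Lemma D1_along g x t :
  smooth_on plane g -> smooth_at u x t -> smooth_at s x t ->
  D1 (along g u s) x t =
  along (D1 g) u s x t * D1 (D1 u) x t + along (D2 g) u s x t * D1 s x t.
Proof.
  intros Hg Hu Hs; apply is_derive_unique, (smooth_at_comp_is_derive1 g (D1 u) s); trivial.
  - now apply Hg.
  - now apply smooth_at_D1.
Qed.

Lemma D2_along g x t :
  smooth_on plane g -> smooth_at u x t -> smooth_at s x t ->
  D2 (along g u s) x t =
  along (D1 g) u s x t * D2 (D1 u) x t + along (D2 g) u s x t * D2 s x t.
Proof.
  intros Hg Hu Hs; apply is_derive_unique, (smooth_at_comp_is_derive2 g (D1 u) s); trivial.
  - now apply Hg.
  - now apply smooth_at_D1.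
Qed.

Lemma smooth_on_D1_plane g : smooth_on plane g -> smooth_on plane (D1 g).
Proof. intros Hg p q K; now apply smooth_at_D1, Hg. Qed.

Lemma smooth_on_D2_plane g : smooth_on plane g -> smooth_on plane (D2 g).
Proof. intros Hg p q K; now apply smooth_at_D2, Hg. Qed.

Lemma smooth_at_heat_flux x t :
  smooth_at u x t -> smooth_at s x t -> smooth_at (heat_flux k e u s) x t.
Proof.
  intros Hu Hs; apply smooth_at_scal, smooth_at_D1, smooth_at_along; trivial.
  apply smooth_on_temperature.
Qed.

Lemma smooth_at_total_energy x t :
  smooth_at u x t -> smooth_at s x t -> smooth_at (total_energy e u s) x t.
Proof.
  intros Hu Hs.
  apply smooth_at_ext_loc with
    (fun x t => along e u s x t + / 2 * (velocity u x t * velocity u x t)).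
  - apply locally_2d_forall; intros y z; unfold total_energy; ring.
  - apply smooth_at_plus; [now apply smooth_at_along|].
    now apply smooth_at_scal, smooth_at_mult; apply (smooth_at_D2 u).
Qed.

Lemma smooth_at_stiffness x t :
  smooth_at u x t -> smooth_at s x t -> smooth_at (stiffness rho0 e u s) x t.
Proof.
  intros Hu Hs; apply smooth_at_along; trivial.
  apply smooth_on_D1_plane, smooth_on_stress.
Qed.

Lemma smooth_at_dissipation x t :
  smooth_at u x t -> smooth_at s x t -> smooth_at (dissipation rho0 k e u s) x t.
Proof.
  intros Hu Hs; unfold dissipation.
  pose proof smooth_on_stress; pose proof smooth_on_temperature.
  apply smooth_at_minus; [apply smooth_at_plus|].
  - repeat apply smooth_at_mult.
    + auto using smooth_at_along, smooth_on_D2_plane.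
    + now apply (smooth_at_D2 u).
    + now apply smooth_at_D2.
  - apply smooth_at_mult; [now apply smooth_at_D1|].
    apply smooth_at_minus; apply smooth_at_mult;
      auto using smooth_at_along, smooth_on_D1_plane.
  - now apply smooth_at_D2, smooth_at_heat_flux.
Qed.

(** In [v_t S + v S_t - q_t], momentum balance makes the first term [e_p S_x]. Expanding [S_x] and
    [S_t], the terms with [u_xx] and [u_xt] are those of [c I_x], and [v S_s s_t] is the first term
    of the dissipation. What remains is [e_p S_s s_x], equal to [S theta_p s_x] by the Maxwell
    relation; the term [- theta c s_x] of the dissipation cancels the contribution of [theta s_x] to
    [c I_x]. *)
Lemma D2_energy_flux x t :
  smooth_at u x t -> smooth_at s x t ->
  rho0 * D2 (velocity u) x t = D1 (along (stress rho0 e) u s) x t ->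
  D2 (fun x t => velocity u x t * along (stress rho0 e) u s x t - heat_flux k e u s x t) x t
  = stiffness rho0 e u s x t * D1 (total_energy e u s) x t + dissipation rho0 k e u s x t.
Proof.
  intros Hu Hs Hm.
  pose proof smooth_on_stress as HS; pose proof smooth_on_temperature as HT.
  assert (Hv : smooth_at (velocity u) x t) by now apply (smooth_at_D2 u).
  assert (HSa : smooth_at (along (stress rho0 e) u s) x t) by now apply smooth_at_along.
  assert (Hq : smooth_at (heat_flux k e u s) x t) by now apply smooth_at_heat_flux.
  assert (HP : D2 (fun x t => velocity u x t * along (stress rho0 e) u s x t
                              - heat_flux k e u s x t) x t =
    D2 (velocity u) x t * along (stress rho0 e) u s x t
    + velocity u x t * D2 (along (stress rho0 e) u s) x t - D2 (heat_flux k e u s) x t).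
  { unfold D2 at 1; rewrite Derive_minus, Derive_mult; [reflexivity| | | |].
    - exact (smooth_at_ex_derive2 _ _ _ Hv).
    - exact (smooth_at_ex_derive2 _ _ _ HSa).
    - exact (smooth_at_ex_derive2 _ _ _ (smooth_at_mult _ _ _ _ Hv HSa)).
    - exact (smooth_at_ex_derive2 _ _ _ Hq). }
  assert (HI : D1 (total_energy e u s) x t =
    D1 (along e u s) x t + velocity u x t * D1 (velocity u) x t).
  { transitivity (Derive (fun z =>
      along e u s z t + / 2 * (velocity u z t * velocity u z t)) x).
    - apply Derive_ext; intros z; unfold total_energy; ring.
    - rewrite Derive_plus, Derive_scal, Derive_mult.
      + unfold D1; field.
      + now apply smooth_at_ex_derive1.
      + now apply smooth_at_ex_derive1.
      + now apply smooth_at_ex_derive1, smooth_at_along.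
      + now apply (smooth_at_ex_derive1
          (fun x t => / 2 * (velocity u x t * velocity u x t))),
          smooth_at_scal, smooth_at_mult. }
  assert (Hvx : D1 (velocity u) x t = D2 (D1 u) x t) by now apply smooth_at_D1_D2.
  assert (HSs : forall p q, D2 (stress rho0 e) p q = rho0 * D2 (D1 e) p q)
    by (intros p q; apply Derive_scal).
  assert (HTp : forall p q, D1 (temperature e) p q = D2 (D1 e) p q)
    by (intros p q; now apply smooth_at_D1_D2, He).
  rewrite D1_along in Hm by trivial.
  rewrite HP, HI, D2_along, D1_along by trivial.
  unfold dissipation, stiffness.
  (* The factor [rho0] inside [S = rho0 e_p] is lent to [v_t], so momentum balance applies without a
     division. *)
  replace (D2 (velocity u) x t * along (stress rho0 e) u s x t) with
    (along (D1 e) u s x t * (rho0 * D2 (velocity u) x t))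
    by (unfold along, stress; ring).
  rewrite Hm, Hvx.
  unfold along; rewrite HSs, HTp; unfold temperature.
  (* Occurrence 4 is the undifferentiated stress in the dissipation; the others sit under [D1] and
     must stay atoms for [ring]. *)
  unfold stress at 4; ring.
Qed.

End Motion.

Lemma total_energy_wave_equation a b tau rho0 k e u s :
  smooth_on plane e ->
  smooth_on (closed_cylinder a b tau) u -> smooth_on (closed_cylinder a b tau) s ->
  (forall x t, cylinder a b tau x t ->
     rho0 * D2 (velocity u) x t = D1 (along (stress rho0 e) u s) x t) ->
  (forall x t, cylinder a b tau x t ->
     rho0 * D2 (total_energy e u s) x t =
     D1 (fun x' t' => velocity u x' t' * along (stress rho0 e) u s x' t'
                      - heat_flux k e u s x' t') x t) ->
  forall x t, cylinder a b tau x t ->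
  wave_operator rho0 (stiffness rho0 e u s) (dissipation rho0 k e u s)
    (total_energy e u s) x t = 0.
Proof.
  intros He Hu Hs Hmom Hfirst x t K.
  pose proof (cylinder_locally _ _ _ _ _ K) as Kloc.
  assert (Su : forall x t, cylinder a b tau x t -> smooth_at u x t)
    by (intros; now apply Hu, cylinder_closed).
  assert (Ss : forall x t, cylinder a b tau x t -> smooth_at s x t)
    by (intros; now apply Hs, cylinder_closed).
  set (P x t := velocity u x t * along (stress rho0 e) u s x t - heat_flux k e u s x t).
  assert (HP : smooth_at P x t).
  { apply smooth_at_minus; [apply smooth_at_mult|].
    - now apply (smooth_at_D2 u), Su.
    - apply smooth_at_along; auto using smooth_on_stress.
    - apply smooth_at_heat_flux; auto. }
  assert (E : rho0 * D2 (D2 (total_energy e u s)) x t =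
    D1 (fun x t => stiffness rho0 e u s x t * D1 (total_energy e u s) x t
                   + dissipation rho0 k e u s x t) x t).
  { transitivity (D2 (D1 P) x t).
    - transitivity (Derive (fun z => rho0 * D2 (total_energy e u s) x z) t);
        [symmetry; apply Derive_scal|].
      (* The first law holds at all points near [(x, t)], hence along the vertical line through it,
         and may be differentiated in [t]. *)
      apply Derive_ext_loc.
      apply (locally_2d_1d_const_x (fun x z =>
        rho0 * D2 (total_energy e u s) x z = D1 P x z)).
      eapply locally_2d_mono; [|exact Kloc]; exact Hfirst.
    - rewrite <- smooth_at_D1_D2 by exact HP.
      (* After the exchange of derivatives, the formula for [D2 P] is likewise available on a
         neighbourhood and may be differentiated in [x]. *)
      apply Derive_ext_loc.
      apply (locally_2d_1d_const_y (fun z t => D2 P z t =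
        stiffness rho0 e u s z t * D1 (total_energy e u s) z t
        + dissipation rho0 k e u s z t)).
      eapply locally_2d_mono; [|exact Kloc].
      intros y z Kyz; apply D2_energy_flux; auto. }
  unfold wave_operator; rewrite E.
  unfold D1 at 1; rewrite Derive_plus; [unfold D1; ring | |].
  - apply (smooth_at_ex_derive1 (fun x t =>
      stiffness rho0 e u s x t * D1 (total_energy e u s) x t)).
    apply smooth_at_mult; [|apply smooth_at_D1].
    + apply smooth_at_stiffness; auto.
    + apply smooth_at_total_energy; auto.
  - apply smooth_at_ex_derive1, smooth_at_dissipation; auto.
Qed.

Theorem mainTheorem8
  (a1 a2 tau rho0 k : R) (e u s : R -> R -> R)
  (Ha : a1 < a2) (Htau : 0 < tau) (Hrho : 0 < rho0)
  (He : smooth_on plane e)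
  (Hu : smooth_on (closed_cylinder a1 a2 tau) u)
  (Hs : smooth_on (closed_cylinder a1 a2 tau) s)
  (momentum_balance : forall x t, cylinder a1 a2 tau x t ->
     rho0 * D2 (velocity u) x t = D1 (along (stress rho0 e) u s) x t)
  (first_law : forall x t, cylinder a1 a2 tau x t ->
     rho0 * D2 (total_energy e u s) x t =
     D1 (fun x' t' => velocity u x' t' * along (stress rho0 e) u s x' t'
                      - heat_flux k e u s x' t') x t) :
  let c := stiffness rho0 e u s in
  let D := dissipation rho0 k e u s in
  let L := energy_density rho0 c D in
  let lhs (J : R -> R -> R) (x t : R) :=
    rho0 * D2 (D2 J) x t
    - D1 (fun x' t' => c x' t' * D1 J x' t') x t
    - D1 D x t in
  (forall x t, cylinder a1 a2 tau x t -> lhs (total_energy e u s) x t = 0)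
  /\
  (forall J : R -> R -> R, smooth_on (closed_cylinder a1 a2 tau) J ->
     forall x t, cylinder a1 a2 tau x t -> euler_lagrange L J x t = lhs J x t)
  /\
  (forall J : R -> R -> R, smooth_on (closed_cylinder a1 a2 tau) J ->
     ((forall x t, cylinder a1 a2 tau x t -> lhs J x t = 0)
      <-> stationary L a1 a2 tau J)).
Proof.
  intros c D L lhs.
  assert (Hc : smooth_on (closed_cylinder a1 a2 tau) c)
    by (intros x t K; now apply smooth_at_stiffness; [| apply Hu | apply Hs]).
  assert (HD : smooth_on (closed_cylinder a1 a2 tau) D)
    by (intros x t K; now apply smooth_at_dissipation; [| apply Hu | apply Hs]).
  split; [|split].
  - now apply (total_energy_wave_equation a1 a2 tau).
  - intros J HJ x t K.
    now apply (euler_lagrange_energy_density a1 a2 tau); [..|apply cylinder_closed].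
  - intros J HJ; symmetry; now apply stationary_iff_wave_operator_eq_0.
Qed.
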